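(* Let $A\in M_k\otimes M_k$ be a weak irreducible SPC matrix. Let $A=\sum_{i=1}^n\lambda_i\gamma_i\otimes\gamma_i$ be a Hermitian Schmidt decomposition of $A$ with $\lambda_1\geq\dots\geq\lambda_n>0$, where $n\geq 2$. Let $\mu$ be the least positive eigenvalue of $\gamma_1\otimes\gamma_1$. If $$\frac{\lambda_1\mu}{\lambda_2+\dots+\lambda_n}\geq\frac12,$$ then $A$ is separable.
   Context: $M_k$ denotes the complex $k\times k$ matrices, and $M_k\otimes M_m$ is identified with $M_{km}$ via the Kronecker product. $M_k$ carries the inner product $\langle C,D\rangle=\mathrm{tr}(CD^* )$. A Hermitian projection is an orthogonal projection matrix. A Hermitian Schmidt decomposition of a Hermitian $A\in M_k\otimes M_m$ is an expression $A=\sum_{i=1}^n\lambda_i\gamma_i\otimes\delta_i$ with real $\lambda_i>0$, where $\{\gamma_1,\dots,\gamma_n\}\subset M_k$ and $\{\delta_1,\dots,\delta_n\}\subset M_m$ are orthonormal sets of Hermitian matrices. A positive semidefinite Hermitian matrix $A\in M_k\otimes M_k$ is SPC (symmetric with positive coefficients) if it has a Hermitian Schmidt decomposition of the form $A=\sum_{i=1}^n\lambda_i\gamma_i\otimes\gamma_i$ with all $\lambda_i>0$. A positive semidefinite Hermitian matrix $A\in M_k\otimes M_m$ is weak irreducible if, for all Hermitian projections $V_1,V_2\in M_k$ and $W_1,W_2\in M_m$ with $V_1V_2=0$, $W_1W_2=0$, $V_1+V_2=Id\in M_k$ and $W_1+W_2=Id\in M_m$, the equality $A=\sum_{i=1}^2(V_i\otimes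 W_i)A(V_i\otimes W_i)$ implies that $(V_1\otimes W_1)A(V_1\otimes W_1)=0$ or $(V_2\otimes W_2)A(V_2\otimes W_2)=0$. $A\in M_k\otimes M_m$ is separable if $A=\sum_{i} C_i\otimes D_i$ (finite sum) with $C_i\in M_k$ and $D_i\in M_m$ positive semidefinite Hermitian for every $i$. *)

(* Defs.v *)
From mathcomp Require Export all_boot all_order all_algebra.
From mathcomp Require Export reals.
From mathcomp Require Export complex mxtens.

Set Implicit Arguments.
Unset Strict Implicit.
Unset Printing Implicit Defensive.

Import Order.TTheory GRing.Theory Num.Theory.
Local Open Scope ring_scope.
Local Open Scope complex_scope.
Local Open Scope sesquilinear_scope.

(* On R[i] the relation 0 <= z means that z is real and nonnegative. *)
Definition psdmx (R : realType) (k : nat) (A : 'M[R[i]]_k) : Prop :=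
  A \is hermsymmx /\ forall v : 'cV[R[i]]_k, 0 <= (v ^t* *m A *m v) ord0 ord0.

Definition herm_proj (R : realType) (k : nat) (V : 'M[R[i]]_k) : Prop :=
  V \is hermsymmx /\ V *m V = V.

Definition mxinner (R : realType) (k : nat) (C D : 'M[R[i]]_k) : R[i] :=
  \tr (C *m D ^t*).

Definition orthonormal_family (R : realType) (k n : nat)
    (gamma : 'I_n -> 'M[R[i]]_k) : Prop :=
  forall i j : 'I_n, mxinner (gamma i) (gamma j) = (i == j)%:R.

Definition herm_schmidt (R : realType) (k m n : nat) (A : 'M[R[i]]_(k * m))
    (lambda : 'I_n -> R) (gamma : 'I_n -> 'M[R[i]]_k)
    (delta : 'I_n -> 'M[R[i]]_m) : Prop :=
  [/\ A \is hermsymmx /\ (forall i, 0 < lambda i),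
      (forall i, gamma i \is hermsymmx) /\ (forall i, delta i \is hermsymmx),
      orthonormal_family gamma /\ orthonormal_family delta
    & A = \sum_(i < n) (lambda i)%:C *: (gamma i *t delta i)].

Definition spc (R : realType) (k : nat) (A : 'M[R[i]]_(k * k)) : Prop :=
  psdmx A /\
  exists (n : nat) (lambda : 'I_n -> R) (gamma : 'I_n -> 'M[R[i]]_k),
    herm_schmidt A lambda gamma gamma.

Definition weak_irreducible (R : realType) (k m : nat)
    (A : 'M[R[i]]_(k * m)) : Prop :=
  psdmx A /\
  forall (V1 V2 : 'M[R[i]]_k) (W1 W2 : 'M[R[i]]_m),
    herm_proj V1 -> herm_proj V2 -> herm_proj W1 -> herm_proj W2 ->
    V1 *m V2 = 0 -> W1 *m W2 = 0 -> V1 + V2 = 1%:M -> W1 + W2 = 1%:M ->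
    A = (V1 *t W1) *m A *m (V1 *t W1) + (V2 *t W2) *m A *m (V2 *t W2) ->
    (V1 *t W1) *m A *m (V1 *t W1) = 0 \/ (V2 *t W2) *m A *m (V2 *t W2) = 0.

Definition separable_mx (R : realType) (k m : nat) (A : 'M[R[i]]_(k * m)) : Prop :=
  exists (N : nat) (C : 'I_N -> 'M[R[i]]_k) (D : 'I_N -> 'M[R[i]]_m),
    (forall i, psdmx (C i) /\ psdmx (D i)) /\
    A = \sum_(i < N) (C i *t D i).

Definition least_pos_eigenvalue (R : realType) (d : nat) (B : 'M[R[i]]_d)
    (mu : R) : Prop :=
  [/\ 0 < mu, eigenvalue B mu%:C
    & forall nu : R, 0 < nu -> eigenvalue B nu%:C -> mu <= nu].

(* Main.v *)
(* Since A is positive semidefinite, X |-> sum_i lambda_i tr(gamma_i X) gamma_i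
   is a positive self-adjoint map with largest eigenvalue lambda_1, attained at
   gamma_1, hence also at |gamma_1|.  Consequently A vanishes on u (x) v for u
   in the positive part of gamma_1 and v orthogonal to it, and evaluating A
   between u (x) v and v (x) u gives that every gamma_i is block diagonal for
   this splitting.  Weak irreducibility kills the second block, so gamma_1 is
   semidefinite and every gamma_i lives on its range, with projection E.  Then
   A = (lambda_1 gamma_1 (x) gamma_1 - c E (x) E)
       + sum_(i > 1) lambda_i (E (x) E / 2 + gamma_i (x) gamma_i),
   c = (lambda_2 + ... + lambda_n) / 2 <= lambda_1 mu, and each summand is
   diagonal with nonnegative entries in some product basis. *)
Require Import Defs.
From mathcomp Require Import ring lra.
Set Implicit Arguments.
Unset Strict Implicit.
Unset Printing Implicit Defensive.

Import Order.TTheory GRing.Theory Num.Theory.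
Local Open Scope ring_scope.
Local Open Scope complex_scope.
Local Open Scope sesquilinear_scope.

(** * Positive semidefinite matrices and closure properties of separability *)

Section Separability.
Variable R : realType.
Local Notation C := R[i].

Lemma hermmxP k (A : 'M[C]_k) : reflect (A ^t* = A) (A \is hermsymmx).
Proof.
by apply: (iffP (is_hermitianmxP _ _ _)) => /=; rewrite expr0 scale1r => /esym.
Qed.

Lemma ctmxM m n p (A : 'M[C]_(m, n)) (B : 'M[C]_(n, p)) :
  (A *m B) ^t* = B ^t* *m A ^t*.
Proof. by rewrite trmx_mul map_mxM. Qed.

Lemma ctmxD m n (A B : 'M[C]_(m, n)) : (A + B) ^t* = A ^t* + B ^t*.
Proof. by apply/matrixP => i j; rewrite !mxE rmorphD. Qed.

Lemma ctmxZ m n (c : C) (A : 'M[C]_(m, n)) : (c *: A) ^t* = c^*%R *: A ^t*.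
Proof. by apply/matrixP => i j; rewrite !mxE rmorphM. Qed.

Lemma ctmx_tens m n p q (A : 'M[C]_(m, n)) (B : 'M[C]_(p, q)) :
  (A *t B) ^t* = A ^t* *t B ^t*.
Proof. by rewrite trmx_tens map_mxT. Qed.

Lemma ctmxE m n (A : 'M[C]_(m, n)) i j : (A ^t*) i j = (A j i)^*%R.
Proof. by rewrite !mxE. Qed.

Lemma herm_entryC k (A : 'M[C]_k) i j : A \is hermsymmx -> A i j = (A j i)^*%R.
Proof. by move=> /hermmxP {1}<-; rewrite ctmxE. Qed.

Lemma tens11 k m : (1%:M : 'M[C]_k) *t (1%:M : 'M[C]_m) = 1%:M.
Proof.
apply/matrixP => p q; case: (mxtens_indexP p) => a b; case: (mxtens_indexP q) => c d.
rewrite tensmxE !mxE (can_eq (@mxtens_indexK k m)) xpair_eqE.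
by case: (a == c); case: (b == d); rewrite ?mulr0 ?mul0r ?mul1r.
Qed.

Lemma psdmx_conj k m (X : 'M[C]_(k, m)) (A : 'M[C]_k) :
  psdmx A -> psdmx (X ^t* *m A *m X).
Proof.
move=> [/hermmxP hA pA]; split.
  by apply/hermmxP; rewrite !ctmxM hA trmxCK mulmxA.
move=> v; have := pA (X *m v).
by rewrite ctmxM !mulmxA.
Qed.

Lemma psdmx_scale k (c : C) (A : 'M[C]_k) : 0 <= c -> psdmx A -> psdmx (c *: A).
Proof.
move=> c0 [/hermmxP hA pA]; split.
  apply/hermmxP; apply/matrixP=> i j.
  rewrite !mxE rmorphM /= -[in RHS]hA !mxE; congr (_ * _).
  exact/CrealP/ger0_real.
by move=> v; rewrite -scalemxAr -scalemxAl mxE mulr_ge0.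
Qed.

Lemma psdmx_delta k (a : 'I_k) : psdmx (delta_mx a a : 'M[C]_k).
Proof.
split.
  by apply/hermmxP; rewrite trmx_delta map_delta_mx.
move=> v; rewrite -(mul_delta_mx (0 : 'I_1)).
rewrite mulmxA -mulmxA mxE big_ord1.
rewrite -colE -rowE !mxE mulrC.
exact: mul_conjC_ge0.
Qed.

Lemma separable0 k m : separable_mx (0 : 'M[C]_(k * m)).
Proof.
exists 0%N, (fun=> 0), (fun=> 0); split; first by case.
by rewrite big_ord0.
Qed.

Lemma separableD k m (A B : 'M[C]_(k * m)) :
  separable_mx A -> separable_mx B -> separable_mx (A + B).
Proof.
move=> [N [F [G [FG ->]]]] [N' [F' [G' [FG' ->]]]].
exists (N + N')%N.
exists (fun i => match split i with inl j => F j | inr j => F' j end).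
exists (fun i => match split i with inl j => G j | inr j => G' j end).
split; first by move=> i; case: split.
rewrite big_split_ord /=; congr (_ + _); apply: eq_bigr => i _.
  by rewrite (unsplitK (inl i)).
by rewrite (unsplitK (inr i)).
Qed.

Lemma separable_sum k m (I : Type) (r : seq I) (P : pred I)
    (F : I -> 'M[C]_(k * m)) :
  (forall i, P i -> separable_mx (F i)) -> separable_mx (\sum_(i <- r | P i) F i).
Proof.
by move=> H; apply: big_ind => //; [exact: separable0 | exact: separableD].
Qed.

Lemma separable_tens k m (X : 'M[C]_k) (Y : 'M[C]_m) :
  psdmx X -> psdmx Y -> separable_mx (X *t Y).
Proof. by move=> pX pY; exists 1%N, (fun=> X), (fun=> Y); rewrite big_ord1. Qed.

Lemma scale_tens k m p q (c : C) (X : 'M[C]_(k, m)) (Y : 'M[C]_(p, q)) :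
  (c *: X) *t Y = c *: (X *t Y).
Proof. by apply/matrixP=> i j; rewrite !mxE mulrA. Qed.

Lemma separable_scale k m (c : C) (A : 'M[C]_(k * m)) :
  0 <= c -> separable_mx A -> separable_mx (c *: A).
Proof.
move=> c0 [N [F [G [FG ->]]]]; exists N, (fun i => c *: F i), G; split.
  by move=> i; have [f g] := FG i; split=> //; exact: psdmx_scale.
by rewrite scaler_sumr; apply: eq_bigr => i _; rewrite scale_tens.
Qed.

(** Serves both for product unitaries, which change basis, and for a product of projections, which
    compresses to a common support. *)
Lemma separable_conj k m k' m' (X : 'M[C]_(k, k')) (Y : 'M[C]_(m, m'))
    (A : 'M[C]_(k * m)) :
  separable_mx A -> separable_mx ((X *t Y) ^t* *m A *m (X *t Y)).
Proof.
move=> [N [F [G [FG ->]]]].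
exists N, (fun i => X ^t* *m F i *m X), (fun i => Y ^t* *m G i *m Y); split.
  by move=> i; have [f g] := FG i; split; exact: psdmx_conj.
rewrite mulmx_sumr mulmx_suml; apply: eq_bigr => i _.
by rewrite ctmx_tens !tensmx_mul.
Qed.

(** Such a matrix is a nonnegative combination of the products [delta_mx a a *t delta_mx b b]. The
    later separability claims end here, once a product basis diagonalizes the matrix. *)
Lemma separable_diag k m (D : 'rV[C]_(k * m)) :
  (forall a b, 0 <= D 0 (mxtens_index (a, b))) -> separable_mx (diag_mx D).
Proof.
move=> D0.
have -> : diag_mx D = \sum_(a < k) \sum_(b < m)
    D 0 (mxtens_index (a, b)) *: (delta_mx a a *t delta_mx b b).
  apply/matrixP => p q.
  case: (mxtens_indexP p) => a b; case: (mxtens_indexP q) => c d.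
  rewrite summxE (bigD1 a) //= summxE (bigD1 b) //= !mxE !mxtens_indexK !eqxx /=.
  rewrite big1 ?addr0 => [|j jb]; last first.
    by rewrite !mxE !mxtens_indexK [b == j]eq_sym (negPf jb) /= !mulr0.
  rewrite big1 ?addr0 => [|i ia]; last first.
    rewrite summxE big1 // => j _.
    by rewrite !mxE !mxtens_indexK [a == i]eq_sym (negPf ia) /= mul0r mulr0.
  rewrite (can_eq (@mxtens_indexK k m)) xpair_eqE [a == c]eq_sym [b == d]eq_sym.
  by rewrite -natrM mulnb mulr_natr.
apply: separable_sum => a _; apply: separable_sum => b _.
apply: separable_scale => //.
by apply: separable_tens; exact: psdmx_delta.
Qed.

Lemma psdmx_diag_ge0 k (A : 'M[C]_k) s : psdmx A -> 0 <= A s s.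
Proof.
move=> [_ /(_ (delta_mx s 0))].
by rewrite trmx_delta map_delta_mx -rowE -colE !mxE.
Qed.

(** At [x e_s + e_t] the quadratic form loses its [|x|^2] term because [A s s = 0]. It is then
    affine in [x] over the reals, and a nonnegative affine function is constant. *)
Lemma psdmx_diag0 k (A : 'M[C]_k) s t : psdmx A -> A s s = 0 -> A s t = 0.
Proof.
move=> [hA pA] Ass.
set z := A s t; set c := A t t.
have c0 : 0 <= c by exact: (psdmx_diag_ge0 t (conj hA pA)).
have key x : 0 <= x^*%R * z + x * z^*%R + c.
  have := pA (x *: delta_mx s 0 + delta_mx t 0).
  rewrite ctmxD ctmxZ !trmx_delta !map_delta_mx.
  rewrite !mulmxDl !mulmxDr -!scalemxAl -!scalemxAr -!rowE -!colE !mxE.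
  rewrite Ass [A t s](herm_entryC t s hA) -/z -/c !mulr0 add0r.
  by rewrite [X in 0 <= X -> _](_ : _ = x^*%R * z + x * z^*%R + c) //; ring.
apply/eqP; apply: contraT => z0.
(* For nonzero [z] this choice makes both cross terms equal to [- (c + 1)], so the form takes the
   negative value [- (c + 2)]. *)
have /= := key (- (c + 1) / z^*%R).
have zc0 : z^*%R != 0 by rewrite fmorph_eq0.
rewrite fmorph_div rmorphN rmorphD rmorph1 /= conjCK (CrealP _) ?ger0_real //.
rewrite !mulfVK // [X in 0 <= X](_ : _ = - (c + 2)); last by ring.
rewrite oppr_ge0 => h; have : 0 < c + 2 by rewrite ltr_wpDl // ltr0n.
by move=> /lt_le_trans/(_ h); rewrite ltxx.
Qed.

End Separability.

(** * A Perron-Frobenius argument for a symmetric form with nonnegative coefficients *)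

Section Perron.
Variable R : realFieldType.

(** First-order optimality condition: for small [t] of the sign of [c] the linear term would
    dominate the quadratic one. *)
Lemma linear_le_quadratic_eq0 (c M : R) :
  (forall t, 2 * t * c <= t ^+ 2 * M) -> c = 0.
Proof.
move=> H; apply/eqP; rewrite -sqrf_eq0 eq_le sqr_ge0 andbT.
have m0 : 0 < `|M| + 1 by rewrite ltr_wpDl.
(* This [t] yields [2 c^2 (|M| + 1) <= c^2 M], which forces [c^2 = 0]; the added 1 keeps the
   denominator positive. *)
have := H (c / (`|M| + 1)); rewrite expr_div_n.
rewrite -(ler_pM2r (exprn_gt0 2 m0)).
rewrite [X in X <= _](_ : _ = 2 * c ^+ 2 * (`|M| + 1)); last by field; rewrite gt_eqF.
rewrite [X in _ <= X](_ : _ = c ^+ 2 * M); last by field; rewrite gt_eqF.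
have := ler_norm M; have := sqr_ge0 c; have := normr_ge0 M; nra.
Qed.

(** In the application [x i] is the diagonal of gamma_i in an eigenbasis of gamma_1. Such diagonals
    need not be orthonormal: what survives is Bessel's inequality and the inner products with
    [x i1], which is the whole of gamma_1. *)
Variables (k n : nat) (lam : 'I_n -> R) (x : 'I_n -> 'I_k -> R) (i1 : 'I_n).
Hypothesis lam_gt0 : forall i, 0 < lam i.
Hypothesis lam_max : forall i, lam i <= lam i1.
Hypothesis bessel : forall y : 'I_k -> R,
  \sum_i (\sum_a x i a * y a) ^+ 2 <= \sum_a y a ^+ 2.
Hypothesis orth : forall i, \sum_a x i a * x i1 a = (i == i1)%:R.
(** The diagonal entry of A at the product vector e_a (x) e_b, hence nonnegative when A is positive
    semidefinite. *)
Let K a b := \sum_i lam i * (x i a * x i b).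
Hypothesis K_ge0 : forall a b, 0 <= K a b.

Let Q (y : 'I_k -> R) := \sum_i lam i * (\sum_a x i a * y a) ^+ 2.

Let Qmax y : Q y <= lam i1 * \sum_a y a ^+ 2.
Proof.
apply: le_trans (ler_wpM2l (ltW (lam_gt0 i1)) (bessel y)).
by rewrite mulr_sumr; apply: ler_sum => i _; rewrite ler_wpM2r ?sqr_ge0.
Qed.

Let KE b y : \sum_a K b a * y a = \sum_i lam i * ((\sum_a x i a * y a) * x i b).
Proof.
under eq_bigr => a _ do rewrite mulr_suml.
rewrite exchange_big; apply: eq_bigr => i _ /=.
rewrite mulr_suml mulr_sumr; apply: eq_bigr => a _; ring.
Qed.

(** In this form the coefficients are nonnegative, so replacing [y] by its entrywise absolute value
    cannot decrease [Q]. *)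
Let QE y : Q y = \sum_b \sum_a K b a * (y b * y a).
Proof.
transitivity (\sum_b y b * \sum_a K b a * y a); last first.
  apply: eq_bigr => b _; rewrite mulr_sumr; apply: eq_bigr => a _; ring.
under eq_bigr => b _ do rewrite KE mulr_sumr.
rewrite exchange_big; apply: eq_bigr => i _ /=.
rewrite expr2 mulr_sumr mulr_sumr; apply: eq_bigr => a _; ring.
Qed.

Let Qshift y b t : Q (fun a => y a + t * (a == b)%:R) =
  Q y + 2 * t * (\sum_a K b a * y a) + t ^+ 2 * K b b.
Proof.
rewrite KE /K mulr_sumr mulr_sumr -!big_split /=; apply: eq_bigr => i _.
have -> : \sum_a x i a * (y a + t * (a == b)%:R) = \sum_a x i a * y a + t * x i b.
  under eq_bigr => a _ do rewrite mulrDr.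
  rewrite big_split /=; congr (_ + _).
  rewrite (bigD1 b) //= eqxx big1 => [|a /negPf ->]; last by rewrite mulr0 mulr0.
  by rewrite /=; ring.
ring.
Qed.

Let normshift (y : 'I_k -> R) b t : \sum_a (y a + t * (a == b)%:R) ^+ 2 =
  \sum_a y a ^+ 2 + 2 * t * y b + t ^+ 2.
Proof.
rewrite (bigD1 b) //= eqxx [in RHS](bigD1 b) //=.
rewrite (eq_bigr (fun a => y a ^+ 2)) => [|a /negPf ->]; last by rewrite mulr0 addr0.
by rewrite /=; ring.
Qed.

Let d := x i1.
Let e a := `|d a|.

Let Kd b : \sum_a K b a * d a = lam i1 * d b.
Proof.
rewrite KE (bigD1 i1) //= orth eqxx mul1r big1 ?addr0 // => i /negPf ii1.
by rewrite orth ii1 mul0r mulr0.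
Qed.

(* The Rayleigh quotient of the nonnegative form K is maximal at d, hence at
   |d|, so that |d| is again an eigenvector. *)
Let Ke b : \sum_a K b a * e a = lam i1 * e b.
Proof.
have d1 : \sum_a d a ^+ 2 = 1.
  transitivity ((i1 == i1)%:R : R); last by rewrite eqxx.
  by rewrite -orth; apply: eq_bigr => a _; rewrite expr2.
have e1 : \sum_a e a ^+ 2 = 1.
  by rewrite -d1; apply: eq_bigr => a _; rewrite real_normK ?num_real.
have Qe : lam i1 <= Q e.
  have -> : lam i1 = Q d.
    rewrite /Q (bigD1 i1) //= orth eqxx expr1n mulr1 big1 ?addr0 // => i /negPf ii1.
    by rewrite orth ii1 expr0n mulr0.
  rewrite !QE; apply: ler_sum => a _; apply: ler_sum => c _.
  by rewrite ler_wpM2l // -normrM ler_norm.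
apply/eqP; rewrite -subr_eq0; apply/eqP.
(* Comparing [Q] with its upper bound at [|d| + t e_b] leaves [2 t (K |d| - lam i1 |d|)_b <= t^2
   (lam i1 - K b b)]. *)
apply: (@linear_le_quadratic_eq0 _ (lam i1 - K b b)) => t.
have := Qmax (fun a => e a + t * (a == b)%:R).
rewrite Qshift normshift e1; nra.
Qed.

(** The vector [|d| + d] satisfies the eigenvector equation and vanishes at [b]. Row [b] of [K] thus
    pairs to 0 with it; all terms are nonnegative and the weight at [a] is positive. *)
Lemma perron_block_eq0 a b : 0 < x i1 a -> x i1 b <= 0 ->
  \sum_i lam i * (x i a * x i b) = 0.
Proof.
move=> da db.
have Kba : K b a = 0.
  have : \sum_c K b c * (e c + d c) = 0.
    under eq_bigr => c _ do rewrite mulrDr.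
    by rewrite big_split /= Ke Kd -mulrDr /e ler0_norm // addNr mulr0.
  move/eqP; rewrite psumr_eq0 => [|c _]; last first.
    by rewrite mulr_ge0 // /e; have := ler_norm (- d c); rewrite normrN; lra.
  move=> /allP/(_ a (mem_index_enum _)) /=.
  rewrite mulf_eq0 => /orP[/eqP //|].
  by rewrite /e gtr0_norm // gt_eqF // addr_gt0.
by rewrite -[RHS]Kba; apply: eq_bigr => i _; rewrite [x i a * _]mulrC.
Qed.

Lemma perron_eigen b :
  \sum_a (\sum_i lam i * (x i b * x i a)) * x i1 a = lam i1 * x i1 b.
Proof. exact: Kd. Qed.

End Perron.

(** * The trace inner product and Bessel's inequality *)

Section Inner.
Variable R : realType.
Local Notation C := R[i].

Lemma mxinnerE k (X Y : 'M[C]_k) :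
  mxinner X Y = \sum_a \sum_b X a b * (Y a b)^*%R.
Proof.
rewrite /mxinner /mxtrace; apply: eq_bigr => a _; rewrite mxE.
by apply: eq_bigr => b _; rewrite ctmxE.
Qed.

Lemma mxinner_ge0 k (X : 'M[C]_k) : 0 <= mxinner X X.
Proof.
rewrite mxinnerE; apply: sumr_ge0 => a _; apply: sumr_ge0 => b _.
exact: mul_conjC_ge0.
Qed.

Lemma mxinnerC k (X Y : 'M[C]_k) : mxinner X Y = (mxinner Y X)^*%R.
Proof.
rewrite !mxinnerE rmorph_sum; apply: eq_bigr => a _; rewrite rmorph_sum.
by apply: eq_bigr => b _; rewrite rmorphM /= conjCK mulrC.
Qed.

Lemma mxinnerBl k (X Y Z : 'M[C]_k) :
  mxinner (X - Y) Z = mxinner X Z - mxinner Y Z.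
Proof. by rewrite /mxinner mulmxBl linearB. Qed.

Lemma mxinner_suml k n (c : 'I_n -> C) (X : 'I_n -> 'M[C]_k) Z :
  mxinner (\sum_i c i *: X i) Z = \sum_i c i * mxinner (X i) Z.
Proof.
rewrite /mxinner mulmx_suml linear_sum; apply: eq_bigr => i _.
by rewrite -scalemxAl linearZ.
Qed.

(** The residual [E] of projecting [D] onto the span of the [g i] is orthogonal to that span, so the
    nonnegative [<E, E>] equals [<D, E>], the difference of the two sides. *)
Lemma mx_bessel k n (g : 'I_n -> 'M[C]_k) (D : 'M[C]_k) :
  orthonormal_family g ->
  \sum_i `|mxinner D (g i)| ^+ 2 <= mxinner D D.
Proof.
move=> og; set c := fun i => mxinner D (g i).
set S := \sum_i c i *: g i; set E := D - S.
have Eg j : mxinner E (g j) = 0.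
  rewrite mxinnerBl mxinner_suml (bigD1 j) //= og eqxx mulr1 big1 ?addr0 ?subrr //.
  by move=> i /negPf ij; rewrite og ij mulr0.
have ES : mxinner E S = 0.
  rewrite mxinnerC mxinner_suml big1 ?rmorph0 // => i _.
  by rewrite mxinnerC Eg rmorph0 mulr0.
have := mxinner_ge0 E.
have -> : mxinner E E = mxinner D E.
  by rewrite {1}/E mxinnerBl [mxinner S E]mxinnerC ES rmorph0 subr0.
rewrite mxinnerC /E mxinnerBl rmorphB /= -!mxinnerC subr_ge0.
rewrite [mxinner D S]mxinnerC mxinner_suml rmorph_sum.
congr (_ <= _); apply: eq_bigr => i _.
by rewrite [mxinner (g i) D]mxinnerC rmorphM /= conjCK mulrC -normCK.
Qed.

End Inner.

(** * Real diagonal matrices, unitary conjugation and the spectral theorem *)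

Section Diagonal.
Variable R : realType.
Local Notation C := R[i].

Definition rdiag k (d : 'I_k -> R) : 'M[C]_k := diag_mx (\row_a (d a)%:C).

Lemma conjC_real (r : R) : (r%:C)^*%R = r%:C.
Proof. by apply/CrealP/complex_realP; exists r. Qed.

Lemma rdiag_herm k (d : 'I_k -> R) : rdiag d \is hermsymmx.
Proof.
apply/hermmxP/matrixP => a b; rewrite !mxE.
case: eqVneq => [->|_]; first by rewrite mulr1n conjC_real.
by rewrite !mulr0n rmorph0.
Qed.

Lemma rdiagM k (d e : 'I_k -> R) :
  rdiag d *m rdiag e = rdiag (fun a => d a * e a).
Proof.
rewrite /rdiag mul_diag_mx; apply/matrixP => a b; rewrite !mxE.
by case: eqVneq => [->|_]; rewrite ?mulr1n ?mulr0n ?mulr0 // rmorphM.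
Qed.

Lemma eq_rdiag k (d e : 'I_k -> R) : d =1 e -> rdiag d = rdiag e.
Proof. by move=> de; congr diag_mx; apply/rowP => a; rewrite !mxE de. Qed.

Lemma rdiag0 k : rdiag (fun=> 0) = 0 :> 'M[C]_k.
Proof. by apply/matrixP => a b; rewrite !mxE mul0rn. Qed.

Lemma rdiag1 k : rdiag (fun=> 1) = 1%:M :> 'M[C]_k.
Proof. by apply/matrixP => a b; rewrite !mxE. Qed.

Lemma rdiagD k (d e : 'I_k -> R) : rdiag (fun a => d a + e a) = rdiag d + rdiag e.
Proof. by apply/matrixP => a b; rewrite !mxE rmorphD mulrnDl. Qed.

Lemma rdiag_lincomb k (y z : R) (d e : 'I_k -> R) :
  y%:C *: rdiag d + z%:C *: rdiag e = rdiag (fun a => y * d a + z * e a).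
Proof.
apply/matrixP => a b; rewrite !mxE rmorphD !rmorphM mulrnDl.
by rewrite !mulrnAr.
Qed.

Lemma rdiag_tens k m (d : 'I_k -> R) (e : 'I_m -> R) :
  rdiag d *t rdiag e =
  rdiag (fun p : 'I_(k * m) => d (mxtens_unindex p).1 * e (mxtens_unindex p).2).
Proof.
apply/matrixP => p q.
case: (mxtens_indexP p) => a b; case: (mxtens_indexP q) => c f.
rewrite tensmxE !mxE !mxtens_indexK /= (can_eq (@mxtens_indexK k m)) xpair_eqE.
by case: (a == c); case: (b == f);
  rewrite ?mulr1n ?mulr0n ?mulr0 ?mul0r ?mulr0n // rmorphM.
Qed.

Lemma rdiag_conjE k (d : 'I_k -> R) (X : 'M[C]_k) a b :
  (rdiag d *m X *m rdiag d) a b = (d a)%:C * X a b * (d b)%:C.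
Proof. by rewrite /rdiag mul_mx_diag mul_diag_mx !mxE. Qed.

Lemma mxinner_rdiagl k (d : 'I_k -> R) (X : 'M[C]_k) :
  mxinner (rdiag d) X = \sum_a (d a)%:C * (X a a)^*%R.
Proof.
rewrite mxinnerE; apply: eq_bigr => a _; rewrite (bigD1 a) //= !mxE eqxx mulr1n.
rewrite big1 ?addr0 // => b ba.
by rewrite !mxE eq_sym (negPf ba) mulr0n mul0r.
Qed.

Lemma unitary_ctmul k (U : 'M[C]_k) : U \is unitarymx -> U ^t* *m U = 1%:M.
Proof. by move=> uU; rewrite -[U ^t*]mul1mx (mulmxKtV _ uU). Qed.

Lemma unitary_tens k m (U : 'M[C]_k) (W : 'M[C]_m) :
  U \is unitarymx -> W \is unitarymx -> U *t W \is unitarymx.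
Proof.
move=> /unitarymxP uU /unitarymxP uW; apply/unitarymxP.
by rewrite ctmx_tens tensmx_mul uU uW tens11.
Qed.

Lemma mxinner_conj k (U X Y : 'M[C]_k) : U \is unitarymx ->
  mxinner (U *m X *m U ^t*) (U *m Y *m U ^t*) = mxinner X Y.
Proof.
move=> uU; rewrite /mxinner !ctmxM trmxCK !mulmxA (mulmxKtV _ uU) //.
by rewrite mxtrace_mulC !mulmxA unitary_ctmul // mul1mx.
Qed.

Lemma herm_spectral k (X : 'M[C]_k) : X \is hermsymmx ->
  exists (U : 'M[C]_k) (w : 'I_k -> R),
    U \is unitarymx /\ X = U ^t* *m rdiag w *m U.
Proof.
move=> hX; have /orthomx_spectralP eX := hermitian_normalmx hX.
have uU := spectral_unitarymx X.
exists (spectralmx X), (fun a => complex.Re (spectral_diag X 0 a)); split=> //.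
rewrite {1}eX invmx_unitary //; congr (_ *m diag_mx _ *m _).
apply/rowP => a; rewrite mxE RRe_real //.
by have /mxOverP := hermitian_spectral_diag_real hX; apply.
Qed.

(* In an eigenbasis of X the matrix is diagonal with entries
   1/2 + w_a w_b, and w_a^2 + w_b^2 <= 1 for a <> b. *)
Lemma separable_half k (X : 'M[C]_k) : X \is hermsymmx -> mxinner X X = 1 ->
  separable_mx ((2^-1)%:C *: 1%:M + X *t X).
Proof.
move=> hX nX; have [U [w [uU eX]]] := herm_spectral hX.
have w1 : \sum_a w a ^+ 2 = 1.
  apply: complexI; rewrite rmorph_sum -[RHS]nX eX.
  rewrite -[X in _ *m X](trmxCK U) mxinner_conj ?trmxC_unitary // mxinner_rdiagl.
  apply: eq_bigr => a _.
  by rewrite !mxE eqxx mulr1n conjC_real rmorphXn expr2.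
have uUU := unitary_tens uU uU.
have -> : (2^-1)%:C *: 1%:M + X *t X = (U *t U) ^t* *m
    rdiag (fun p => 2^-1 + w (mxtens_unindex p).1 * w (mxtens_unindex p).2)
    *m (U *t U).
  have -> : rdiag (fun p : 'I_(k * k) =>
      2^-1 + w (mxtens_unindex p).1 * w (mxtens_unindex p).2)
    = (2^-1)%:C *: 1%:M + rdiag w *t rdiag w.
    rewrite rdiag_tens; apply/matrixP => p q; rewrite !mxE rmorphD mulrnDl.
    by rewrite mulr_natr.
  rewrite mulmxDr mulmxDl -scalemxAr -scalemxAl mulmx1 unitary_ctmul //.
  by rewrite ctmx_tens !tensmx_mul -eX.
apply/separable_conj/separable_diag => a b.
rewrite mxE mxtens_indexK /= ler0c.
case: (eqVneq a b) => [->|ab]; first by have := sqr_ge0 (w b); nra.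
have : w a ^+ 2 + w b ^+ 2 <= 1.
  rewrite -w1 (bigD1 a) //= (bigD1 b) 1?eq_sym //= addrA lerDl.
  by apply: sumr_ge0 => c _; exact: sqr_ge0.
have := sqr_ge0 (w a + w b); nra.
Qed.

(** Projections splitting the conjugated matrix are pulled back through [U] and [W] to projections
    splitting [A]. This allows gamma_1 to be taken diagonal. *)
Lemma weak_irreducible_conj k m (U : 'M[C]_k) (W : 'M[C]_m) (A : 'M[C]_(k * m)) :
  U \is unitarymx -> W \is unitarymx -> weak_irreducible A ->
  weak_irreducible ((U *t W) *m A *m (U *t W) ^t*).
Proof.
move=> uU uW [pA hA]; have uT := unitary_tens uU uW.
set T := U *t W in uT *; set A' := T *m A *m T ^t*.
split; first by rewrite /A' -{1}(trmxCK T); exact: psdmx_conj.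
move=> V1 V2 W1 W2 hV1 hV2 hW1 hW2 V12 W12 V1D W1D eA.
have proj l (Z V : 'M[C]_l) : Z \is unitarymx -> herm_proj V ->
    herm_proj (Z ^t* *m V *m Z).
  move=> uZ [/hermmxP hV VV]; split.
    by apply/hermmxP; rewrite !ctmxM hV trmxCK mulmxA.
  by rewrite !mulmxA (mulmxtVK _ uZ) -[_ *m V *m V]mulmxA VV.
have orth l (Z V V' : 'M[C]_l) : Z \is unitarymx -> V *m V' = 0 ->
    (Z ^t* *m V *m Z) *m (Z ^t* *m V' *m Z) = 0.
  by move=> uZ VV; rewrite !mulmxA (mulmxtVK _ uZ) -[_ *m V *m V']mulmxA VV
     mulmx0 mul0mx.
have compl l (Z V V' : 'M[C]_l) : Z \is unitarymx -> V + V' = 1%:M ->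
    Z ^t* *m V *m Z + Z ^t* *m V' *m Z = 1%:M.
  by move=> uZ VV; rewrite -mulmxDl -mulmxDr VV mulmx1 unitary_ctmul.
have tens V V' : (U ^t* *m V *m U) *t (W ^t* *m V' *m W) = T ^t* *m (V *t V') *m T.
  by rewrite ctmx_tens !tensmx_mul.
have AE : A = T ^t* *m A' *m T.
  by rewrite !mulmxA unitary_ctmul // mul1mx (mulmxKtV _ uT).
have block V V' : (T ^t* *m (V *t V') *m T) *m A *m (T ^t* *m (V *t V') *m T)
    = T ^t* *m ((V *t V') *m A' *m (V *t V')) *m T.
  by rewrite !mulmxA.
have back X : T ^t* *m X *m T = 0 -> X = 0.
  move=> /(congr1 (fun Y => T *m Y *m T ^t*)).
  rewrite mulmx0 mul0mx !mulmxA (unitarymxP uT) mul1mx.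
  by rewrite (mulmxtVK _ uT).
have := hA _ _ _ _ (proj _ _ _ uU hV1) (proj _ _ _ uU hV2) (proj _ _ _ uW hW1)
  (proj _ _ _ uW hW2) (orth _ _ _ _ uU V12) (orth _ _ _ _ uW W12)
  (compl _ _ _ _ uU V1D) (compl _ _ _ _ uW W1D).
rewrite !tens !block => H.
have [|H1|H2] := H; [|by left; exact: back|by right; exact: back].
by rewrite -mulmxDl -mulmxDr -eA.
Qed.

(** * Common support of the Schmidt factors, with gamma_1 diagonal *)

Section Support.
Variables (k n : nat) (A : 'M[C]_(k * k)) (lam : 'I_n -> R).
Variables (g : 'I_n -> 'M[C]_k) (i1 : 'I_n) (d : 'I_k -> R).
Hypothesis A_irr : weak_irreducible A.
Hypothesis A_schmidt : herm_schmidt A lam g g.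
Hypothesis lam_max : forall i, lam i <= lam i1.
Hypothesis g1E : g i1 = rdiag d.

Let psdA : psdmx A. Proof. by case: A_irr. Qed.
Let lam_gt0 i : 0 < lam i. Proof. by case: A_schmidt => -[]. Qed.
Let g_herm i : g i \is hermsymmx. Proof. by case: A_schmidt => _ []. Qed.
Let g_orth : orthonormal_family g. Proof. by case: A_schmidt => _ _ []. Qed.

Let AE a b c e : A (mxtens_index (a, b)) (mxtens_index (c, e)) =
  \sum_i (lam i)%:C * (g i a c * g i b e).
Proof.
case: A_schmidt => _ _ _ ->; rewrite summxE; apply: eq_bigr => i _.
by rewrite mxE tensmxE.
Qed.

Let x i a := complex.Re (g i a a).
Let gx i a : g i a a = (x i a)%:C.
Proof.
rewrite /x RRe_real //; apply/CrealP; exact/esym/herm_entryC.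
Qed.

Let AxE a b : A (mxtens_index (a, b)) (mxtens_index (a, b)) =
  (\sum_i lam i * (x i a * x i b))%:C.
Proof.
by rewrite AE rmorph_sum; apply: eq_bigr => i _; rewrite !gx !rmorphM.
Qed.

(** Bessel's inequality for the matrix diag(y), whose inner product with [g i] sees only the
    diagonal of [g i]. *)
Let x_bessel (y : 'I_k -> R) :
  \sum_i (\sum_a x i a * y a) ^+ 2 <= \sum_a y a ^+ 2.
Proof.
rewrite -lecR; have := mx_bessel (rdiag y) g_orth.
have -> : mxinner (rdiag y) (rdiag y) = (\sum_a y a ^+ 2)%:C.
  rewrite mxinner_rdiagl rmorph_sum; apply: eq_bigr => a _.
  by rewrite !mxE eqxx mulr1n conjC_real rmorphXn expr2.
congr (_ <= _); rewrite rmorph_sum; apply: eq_bigr => i _.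
have -> : mxinner (rdiag y) (g i) = (\sum_a x i a * y a)%:C.
  rewrite mxinner_rdiagl rmorph_sum; apply: eq_bigr => a _.
  by rewrite gx conjC_real mulrC rmorphM.
by rewrite real_normK ?rmorphXn //; apply/complex_realP; eexists.
Qed.

Let x1 a : x i1 a = d a.
Proof. by rewrite /x g1E !mxE eqxx mulr1n. Qed.

Let x_orth i : \sum_a x i a * x i1 a = (i == i1)%:R.
Proof.
apply: complexI; rewrite rmorph_nat eq_sym -(g_orth i1 i) g1E mxinner_rdiagl.
rewrite rmorph_sum; apply: eq_bigr => a _.
by rewrite gx conjC_real x1 mulrC rmorphM.
Qed.

Let K_ge0 a b : 0 <= \sum_i lam i * (x i a * x i b).
Proof. by rewrite -ler0c -AxE; exact: psdmx_diag_ge0. Qed.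

(** Since [g i] is Hermitian, this entry of A is the sum of the nonnegative terms
    [lam i * |g i a b|^2]. *)
Let A_flip a b : A (mxtens_index (a, b)) (mxtens_index (b, a)) = 0 ->
  forall i, g i a b = 0.
Proof.
rewrite AE => /eqP; rewrite psumr_eq0 => [/allP H i|i _].
  have /= := H i (mem_index_enum _); rewrite mulf_eq0.
  rewrite [g i b a](herm_entryC b a (g_herm i)) mul_conjC_eq0.
  case/orP=> /eqP // /eqP; rewrite fmorph_eq0 => /eqP l0.
  by have := lam_gt0 i; rewrite l0 ltxx.
rewrite mulr_ge0 ?ler0c ?(ltW (lam_gt0 i)) //.
by rewrite [g i b a](herm_entryC b a (g_herm i)) mul_conjC_ge0.
Qed.

Let diag_mixed a b : (0 < d a) != (0 < d b) ->
  A (mxtens_index (a, b)) (mxtens_index (a, b)) = 0.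
Proof.
have P u v : 0 < d u -> d v <= 0 -> A (mxtens_index (u, v)) (mxtens_index (u, v)) = 0.
  move=> du dv.
  by rewrite AxE (perron_block_eq0 lam_gt0 lam_max x_bessel x_orth K_ge0) ?x1.
case: ltP => da; case: ltP => db // _; first exact: P.
rewrite AxE; transitivity (A (mxtens_index (b, a)) (mxtens_index (b, a))).
  by rewrite AxE; congr (_%:C); apply: eq_bigr => i _; rewrite [x i a * _]mulrC.
exact: P.
Qed.

(** A vanishing diagonal entry of a positive semidefinite matrix kills its whole row, including the
    flipped entry. *)
Let g_mixed a b i : (0 < d a) != (0 < d b) -> g i a b = 0.
Proof.
by move=> /diag_mixed Aab; apply: A_flip; exact: psdmx_diag0.
Qed.

Lemma schmidt_support a0 : 0 < d a0 ->
  forall i a b, d a <= 0 -> g i a b = 0.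
Proof.
move=> da0 i a b da.
have [dapos|] := ltP 0 (d b); first by rewrite g_mixed // dapos ltNge da.
(* [s] and [t] are the indicators of the positive part of gamma_1 and of its complement; weak
   irreducibility is tested on this splitting in both factors. *)
move=> db; pose s a : R := (0 < d a)%R%:R; pose t a : R := (~~ (0 < d a)%R)%:R.
have ss : herm_proj (rdiag s).
  split; first exact: rdiag_herm.
  by rewrite rdiagM; apply: eq_rdiag => c; rewrite -natrM mulnb andbb.
have tt : herm_proj (rdiag t).
  split; first exact: rdiag_herm.
  by rewrite rdiagM; apply: eq_rdiag => c; rewrite -natrM mulnb andbb.
have st : rdiag s *m rdiag t = 0.
  by rewrite rdiagM -rdiag0; apply: eq_rdiag => c; rewrite -natrM mulnb andbN.
have s1t : rdiag s + rdiag t = 1%:M.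
  rewrite -rdiag1 -rdiagD; apply: eq_rdiag => c; rewrite /s /t.
  by case: (0 < d c); rewrite ?addr0 ?add0r.
have [|H|H] := A_irr.2 _ _ _ _ ss tt ss tt st st s1t s1t.
- apply/matrixP => p q; rewrite mxE !rdiag_tens !rdiag_conjE.
  case: (mxtens_indexP p) => u v; case: (mxtens_indexP q) => u' v'.
  rewrite !mxtens_indexK /= /s /t.
  (* An entry of A vanishes unless all four indices lie on the same side of the splitting; in that
     case exactly one block reproduces it. *)
  have [e1|/negPf n1] := eqVneq (0 < d u) (0 < d v); last first.
    have -> : A (mxtens_index (u, v)) (mxtens_index (u', v')) = 0.
      by apply: psdmx_diag0 => //; rewrite diag_mixed ?n1.
    by rewrite !mulr0 !mul0r addr0.
  have [e2|/negPf n2] := eqVneq (0 < d u) (0 < d u'); last first.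
    have -> : A (mxtens_index (u, v)) (mxtens_index (u', v')) = 0.
      by rewrite AE big1 // => j _; rewrite (@g_mixed u u') ?n2 // mul0r mulr0.
    by rewrite !mulr0 !mul0r addr0.
  have [e3|/negPf n3] := eqVneq (0 < d v) (0 < d v'); last first.
    have -> : A (mxtens_index (u, v)) (mxtens_index (u', v')) = 0.
      by rewrite AE big1 // => j _; rewrite (@g_mixed v v') ?n3 // mulr0 mulr0.
    by rewrite !mulr0 !mul0r addr0.
  rewrite -e3 -e2 -e1; case: (0 < d u) => /=;
    rewrite ?mulr1 ?mulr0 ?rmorph0 ?rmorph1 ?mul1r ?mulr1 ?mul0r ?addr0 ?add0r //.
(* If the positive block vanished, so would row [a0] of [K], its mixed entries being zero already.
   The eigenvector equation would then give [lam i1 * d a0 = 0]. *)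
- have : lam i1 * d a0 = 0.
    rewrite -x1 -(perron_eigen lam x_orth) big1 // => c _.
    suff -> : \sum_j lam j * (x j a0 * x j c) = 0 by rewrite mul0r.
    apply: complexI; rewrite -AxE rmorph0.
    have [dc|dc] := boolP (0 < d c); last by rewrite diag_mixed // da0 (negPf dc).
    have /matrixP/(_ (mxtens_index (a0, c)) (mxtens_index (a0, c))) := H.
    rewrite !rdiag_tens !rdiag_conjE !mxtens_indexK /= !mxE.
    by rewrite [s a0]/s [s c]/s da0 dc mulr1n mulr1 rmorph1 mul1r mulr1.
  by move/eqP; rewrite mulf_eq0 !gt_eqF.
(* Both [a] and [b] lie outside the positive part, so the flipped entry belongs to the block that
   vanishes. *)
apply: A_flip.
have /matrixP/(_ (mxtens_index (a, b)) (mxtens_index (b, a))) := H.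
rewrite !rdiag_tens !rdiag_conjE !mxtens_indexK /= !mxE.
by rewrite [t a]/t [t b]/t !ltNge da db mulr1n mulr1 rmorph1 mul1r mulr1.
Qed.

End Support.
End Diagonal.

(** * Assembling the separable decomposition *)

Section Assembly.
Variable R : realType.
Local Notation C := R[i].

Lemma separable_of_support k n (lam : 'I_n -> R) (g : 'I_n -> 'M[C]_k)
    (i1 : 'I_n) (d : 'I_k -> R) (mu : R) :
  (forall i, 0 < lam i) -> (forall i, g i \is hermsymmx) ->
  orthonormal_family g -> g i1 = rdiag d ->
  (forall i a b, d a <= 0 -> g i a b = 0) ->
  (forall a b, 0 < d a -> 0 < d b -> mu <= d a * d b) ->
  (\sum_(i < n | i != i1) lam i) / 2 <= lam i1 * mu ->
  separable_mx (\sum_i (lam i)%:C *: (g i *t g i)).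
Proof.
move=> lam0 hg og g1 supp hmu hb.
pose s a : R := (0 < d a)%R%:R.
have gs i : rdiag s *m g i *m rdiag s = g i.
  apply/matrixP => a b; rewrite rdiag_conjE /s.
  have [da|da] := ltP 0 (d a); last by rewrite supp // mulr0 mul0r.
  have [db|db] := ltP 0 (d b); first by rewrite mulr1n rmorph1 mul1r mulr1.
  by rewrite (herm_entryC a b (hg i)) supp // rmorph0 mulr0 ?mul0r.
have ss : rdiag s *m rdiag s = rdiag s.
  by rewrite rdiagM; apply: eq_rdiag => c; rewrite -natrM mulnb andbb.
set E := rdiag s *t rdiag s.
have EE : E ^t* *m 1%:M *m E = E.
  by rewrite mulmx1 ctmx_tens (hermmxP _ (rdiag_herm s)) tensmx_mul ss.
(* The support condition makes [g i] invariant under compression by [s], so this summand is [lam i]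
   times the compression by [E] of the matrix in [separable_half]. *)
have sep_i i : separable_mx ((lam i / 2)%:C *: E + (lam i)%:C *: (g i *t g i)).
  have -> : (lam i / 2)%:C *: E + (lam i)%:C *: (g i *t g i) =
      (lam i)%:C *: (E ^t* *m ((2^-1)%:C *: 1%:M + g i *t g i) *m E).
    rewrite mulmxDr mulmxDl -scalemxAr -scalemxAl EE scalerDr scalerA -rmorphM.
    by rewrite ctmx_tens (hermmxP _ (rdiag_herm s)) !tensmx_mul gs.
  apply: separable_scale; first by rewrite ler0c ltW.
  by apply/separable_conj/separable_half => //; rewrite og eqxx.
set c := (\sum_(i < n | i != i1) lam i) / 2 in hb.
rewrite (bigD1 i1) //=.
have -> : \sum_(i < n | i != i1) (lam i)%:C *: (g i *t g i) =
    - (c%:C *: E) +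
    \sum_(i < n | i != i1) ((lam i / 2)%:C *: E + (lam i)%:C *: (g i *t g i)).
  by rewrite big_split /= -scaler_suml -rmorph_sum /= -mulr_suml addKr.
rewrite addrA -scaleNr -rmorphN; apply: separableD; last by apply: separable_sum.
rewrite g1 /E !rdiag_tens.
rewrite rdiag_lincomb.
apply: separable_diag => a b; rewrite mxE mxtens_indexK /= ler0c.
(* The support condition at [i1] rules out negative diagonal entries of gamma_1. *)
have dd e : d e <= 0 -> d e = 0.
  move=> de; apply: complexI; rewrite rmorph0 -(supp i1 e e de) g1.
  by rewrite !mxE eqxx mulr1n.
have s1 e : 0 < d e -> s e = 1 by rewrite /s => ->.
have s0 e : d e <= 0 -> s e = 0 by rewrite /s leNgt => /negPf ->.
have [da|da] := ltP 0 (d a); last by rewrite dd // s0 // !(mul0r, mulr0) addr0.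
have [db|db] := ltP 0 (d b); last by rewrite (dd b) // (s0 b) // !mulr0 addr0.
(* On the positive block the entry is [lam i1 * (d a * d b) - c]; the other entries were seen to be
   0. *)
rewrite !s1 // !mulr1 subr_ge0 (le_trans hb) // ler_pM2l //.
exact: hmu.
Qed.

Lemma schmidt_conj k n (U : 'M[C]_k) (A : 'M[C]_(k * k)) (lam : 'I_n -> R)
    (g : 'I_n -> 'M[C]_k) :
  U \is unitarymx -> herm_schmidt A lam g g ->
  herm_schmidt ((U *t U) *m A *m (U *t U) ^t*) lam
    (fun i => U *m g i *m U ^t*) (fun i => U *m g i *m U ^t*).
Proof.
move=> uU [[hA lam0] [hg _] [og _] eA].
have hg' i : U *m g i *m U ^t* \is hermsymmx.
  by apply/hermmxP; rewrite !ctmxM trmxCK (hermmxP _ (hg i)) mulmxA.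
have og' : orthonormal_family (fun i => U *m g i *m U ^t*).
  by move=> i j; rewrite mxinner_conj.
split=> //.
  split=> //; apply/hermmxP.
  by rewrite !ctmxM trmxCK (hermmxP _ hA) mulmxA.
rewrite eA mulmx_sumr mulmx_suml; apply: eq_bigr => i _.
by rewrite -scalemxAr -scalemxAl ctmx_tens !tensmx_mul.
Qed.

(** Conjugation by [U] moves to an eigenbasis of gamma_1 and back. The condition on [mu] concerns
    all positive products [d a * d b], so it is unchanged when [d] is replaced by its negative. *)
Lemma separable_of_pos_eigenvalue k n (A : 'M[C]_(k * k)) (lam : 'I_n -> R)
    (g : 'I_n -> 'M[C]_k) (i1 : 'I_n) (U : 'M[C]_k) (d : 'I_k -> R) (mu : R) a0 :
  weak_irreducible A -> herm_schmidt A lam g g ->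
  (forall i, lam i <= lam i1) ->
  U \is unitarymx -> g i1 = U ^t* *m rdiag d *m U -> 0 < d a0 ->
  (forall a b, 0 < d a * d b -> mu <= d a * d b) ->
  (\sum_(i < n | i != i1) lam i) / 2 <= lam i1 * mu ->
  separable_mx A.
Proof.
move=> irrA dA lmax uU g1 da0 hmu hb.
have dA' := schmidt_conj uU dA.
have g1' : U *m g i1 *m U ^t* = rdiag d.
  by rewrite g1 !mulmxA (unitarymxP uU) mul1mx (mulmxtVK _ uU).
have supp := schmidt_support (weak_irreducible_conj uU uU irrA) dA' lmax g1' da0.
have uUU := unitary_tens uU uU.
have -> : A = (U *t U) ^t* *m ((U *t U) *m A *m (U *t U) ^t*) *m (U *t U).
  by rewrite !mulmxA unitary_ctmul // mul1mx (mulmxKtV _ uUU).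
apply: separable_conj; case: dA' => [[_ lam0] [hg _] [og _] ->].
apply: (separable_of_support lam0 hg og g1' supp) hb => a b da db.
by apply: hmu; rewrite mulr_gt0.
Qed.

Lemma eigenvalue_tens k (U g : 'M[C]_k) (d : 'I_k -> R) a b :
  U \is unitarymx -> g = U ^t* *m rdiag d *m U ->
  eigenvalue (g *t g) (d a * d b)%:C.
Proof.
move=> uU ->; have uUU := unitary_tens uU uU.
(* Eigenvectors are row vectors here: the witness is the row of [U *t U] with index [(a, b)]. *)
apply/eigenvalueP; exists (delta_mx 0 (mxtens_index (a, b)) *m (U *t U)).
  rewrite -!tensmx_mul -ctmx_tens !mulmxA (mulmxtVK _ uUU) rdiag_tens.
  rewrite scalemxAl; congr (_ *m _); rewrite -rowE; apply/rowP => q.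
  rewrite !mxE eqxx mxtens_indexK /= eq_sym.
  by case: (q == _); rewrite ?mulr1 ?mulr0.
apply/eqP => /(congr1 (mulmx^~ ((U *t U) ^t*))).
rewrite /= (mulmxtVK _ uUU) mul0mx => /rowP/(_ (mxtens_index (a, b))).
by rewrite !mxE !eqxx => /eqP; rewrite oner_eq0.
Qed.

End Assembly.

Unset Implicit Arguments.

Theorem theorem5p2 (R : realType) (k n : nat) (A : 'M[R[i]]_(k * k))
    (lambda : 'I_n -> R) (gamma : 'I_n -> 'M[R[i]]_k) (mu : R)
    (hn : (1 < n)%N) (i1 := Ordinal (ltnW hn) : 'I_n)
    (hirr : weak_irreducible A) (hspc : spc A)
    (hdec : herm_schmidt A lambda gamma gamma)
    (hsort : forall i j : 'I_n, (i <= j)%N -> lambda j <= lambda i)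
    (hmu : least_pos_eigenvalue (gamma i1 *t gamma i1) mu)
    (hbound : 1 / 2 <= lambda i1 * mu / \sum_(i < n | i != i1) lambda i) :
  separable_mx A.
Proof.
have [[hA lam0] [hg _] [og _] eA] := hdec.
have lmax i : lambda i <= lambda i1 by exact: hsort.
have [U [d [uU g1]]] := herm_spectral (hg i1).
have d_mu a b : 0 < d a * d b -> mu <= d a * d b.
  by case: hmu => _ _ H dab; apply: H => //; exact: eigenvalue_tens uU g1.
have hb : (\sum_(i < n | i != i1) lambda i) / 2 <= lambda i1 * mu.
  have s0 : 0 < \sum_(i < n | i != i1) lambda i.
    rewrite lt0r sumr_ge0 ?andbT => [|i _]; last exact: ltW.
    (* A zero sum would make the quotient 0, as the inverse of 0 is 0, against the lower bound
       1/2. *)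
    apply/eqP => s0; move: hbound; rewrite s0 invr0 mulr0.
    by rewrite leNgt divr_gt0.
  by move: hbound; rewrite ler_pdivlMr // mulrC mulrA mulr1.
case: (boolP [exists a, 0 < d a]) => [/existsP [a0 da0]|/existsPn nd].
  exact: separable_of_pos_eigenvalue hirr hdec lmax uU g1 da0 d_mu hb.
(* gamma_1 has norm 1, so it has a nonzero eigenvalue, which is negative in this case. *)
have [a0 da0] : exists a, d a != 0.
  apply/existsP; apply: contraT => /existsPn d0.
  have := og i1 i1; rewrite eqxx g1.
  have -> : rdiag d = 0 by rewrite -rdiag0; apply: eq_rdiag => a; have /negbNE/eqP := d0 a.
  by rewrite mulmx0 mul0mx /mxinner mul0mx mxtrace0 => /eqP; rewrite eq_sym oner_eq0.
(* Only the products gamma_i (x) gamma_i matter, so gamma may be negated. *)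
have dA : herm_schmidt A lambda (fun i => - gamma i) (fun i => - gamma i).
  have hgN i : - gamma i \is hermsymmx.
    by apply/hermmxP; rewrite -scaleN1r ctmxZ rmorphN rmorph1 (hermmxP _ (hg i)).
  have ogN : orthonormal_family (fun i => - gamma i).
    move=> i j; rewrite -og /mxinner -[- gamma j]scaleN1r ctmxZ rmorphN rmorph1 scaleN1r.
    by rewrite mulmxN mulNmx opprK.
  split=> //; rewrite eA; apply: eq_bigr => i _; congr (_ *: _).
  by apply/matrixP => p q; rewrite !mxE mulrNN.
apply: (separable_of_pos_eigenvalue (d := fun a => - d a) (a0 := a0)
  hirr dA lmax uU _ _ _ hb).
- rewrite g1 -mulNmx -mulmxN; congr (_ *m _ *m _).
  by apply/matrixP => p q; rewrite !mxE rmorphN mulNrn.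
- by rewrite oppr_gt0 lt_neqAle da0 leNgt nd.
- by move=> a b; rewrite mulrNN; exact: d_mu.
Qed.
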